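(* Let $q$ be an odd prime power and let $\alpha,\beta\in\mathbb{F}_{q^2}$ with $\alpha\neq 0$ be such that $d=(\beta^q-\beta)^2+4\alpha^{q+1}$ is a nonsquare in $\mathbb{F}_q$, so that $\mathcal U_{\alpha\beta}$ is a non-classical orthogonal Buekenhout–Metz unital in $\mathrm{PG}(2,q^2)$. Let $P$ be a point with $P\notin\mathcal U_{\alpha\beta}\cup\ell_\infty$. Then the points of $\mathrm{pedal}(P)$ lie on the lines of a Baer pencil whose vertex is a point of $\ell_\infty$. Moreover: (1) If $\alpha$ is a nonsquare in $\mathbb{F}_{q^2}$, then $\mathrm{pedal}(P)$ is an arc. (2) If $\alpha$ is a nonzero square in $\mathbb{F}_{q^2}$, then (a) $\mathrm{pedal}(P)$ is a set of class $(0,1,2,4)$; (b) there are at least $\frac{q-3}{4}$ lines meeting $\mathrm{pedal}(P)$ in exactly $4$ points; (c) every line meeting $\mathrm{pedal}(P)$ in exactly $4$ points contains the vertex of the Baer pencil containing $\mathrm{pedal}(P)$.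
   Context: Points of $\mathrm{PG}(2,q^2)$ have homogeneous coordinates $(x,y,z)$ over $\mathbb{F}_{q^2}$; $\ell_\infty$ is the line $z=0$. For $\alpha,\beta\in\mathbb{F}_{q^2}$, $\mathcal U_{\alpha\beta}=\{(x,\alpha x^2+\beta x^{q+1}+r,1): x\in\mathbb{F}_{q^2}, r\in\mathbb{F}_q\}\cup\{(0,1,0)\}$. Under the stated nonsquare condition on $d$, $\mathcal U_{\alpha\beta}$ is a unital (a set of $q^3+1$ points meeting every line in $1$ or $q+1$ points), and $\alpha\neq0$ means it is non-classical. A tangent line is a line meeting the unital in exactly one point. For a point $P$ not on the unital there are exactly $q+1$ tangent lines through $P$; their points of contact with the unital are the feet of $P$, and the set of feet is $\mathrm{pedal}(P)$. A point set $\mathcal K$ is of type $(a_1,\dots,a_k)$ if every line meets $\mathcal K$ in some $a_i$ points, and of class $(a_1,\dots,a_k)$ if moreover each $a_i$ occurs as an intersection size for some line. An arc is a set of type $(0,1,2)$. A Baer subline is a set of $q+1$ points of a line of $\mathrm{PG}(2,q^2)$ projectively equivalent to $\{(a,b,0): (a,b)\in\mathbb{F}_q^2\setminus\{(0,0)\}\}$; a Baer pencil is the set of $q+1$ lines joining a point (the vertex) to the points of a Baer subline (the base). *)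

(* Defs.v *)
From HB Require Import structures.
From mathcomp Require Import all_boot all_order all_algebra all_field.
Set Implicit Arguments. Unset Strict Implicit. Unset Printing Implicit Defensive.
Import GRing.Theory.
Local Open Scope ring_scope.

(* Projective plane PG(2, F) over a finite field F (F plays the role of F_{q^2}).
   Points and lines are represented by normalized row vectors of 'rV[F]_3:
   nonzero vectors whose first nonzero coordinate equals 1 (one canonical
   representative per projective point / line). *)

Section PG2.
Variable F : finFieldType.

Definition vec3 (a b c : F) : 'rV[F]_3 := \row_(i < 3) [:: a; b; c]`_i.

Definition normalized (v : 'rV[F]_3) : bool :=
  [exists i : 'I_3, (v 0 i == 1) && [forall j : 'I_3, (j < i)%N ==> (v 0 j == 0)]].

Definition ppoint (v : 'rV[F]_3) : bool := normalized v.
Definition pline (l : 'rV[F]_3) : bool := normalized l.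

Definition on (v l : 'rV[F]_3) : bool := (v *m l^T) 0 0 == 0.

Definition prop (u v : 'rV[F]_3) : bool := [exists k : F, (k != 0) && (u == k *: v)].

Definition meet (K : {set 'rV[F]_3}) (l : 'rV[F]_3) : nat :=
  #|[set v in K | on v l]|.

Definition linf : 'rV[F]_3 := vec3 0 0 1.

Definition of_type (K : {set 'rV[F]_3}) (S : seq nat) : Prop :=
  forall l, pline l -> meet K l \in S.

Definition of_class (K : {set 'rV[F]_3}) (S : seq nat) : Prop :=
  of_type K S /\ forall n, n \in S -> exists l, pline l /\ meet K l = n.

Definition is_arc (K : {set 'rV[F]_3}) : Prop := of_type K [:: 0%N; 1%N; 2%N].

Definition tangent (U : {set 'rV[F]_3}) (l : 'rV[F]_3) : bool :=
  pline l && (meet U l == 1%N).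

Definition pedal (U : {set 'rV[F]_3}) (P : 'rV[F]_3) : {set 'rV[F]_3} :=
  [set Q in U | [exists l, [&& tangent U l, on P l & on Q l]]].

Definition inFq (q : nat) (x : F) : bool := x ^+ q == x.

Definition baer_subline (q : nat) (B : {set 'rV[F]_3}) : Prop :=
  exists M : 'M[F]_3, M \in unitmx /\
    B = [set v | ppoint v && [exists a : F, exists b : F,
           [&& inFq q a, inFq q b, (a != 0) || (b != 0) &
               prop v (vec3 a b 0 *m M)]]].

(* Baer pencil with vertex V and base B: the q+1 lines joining V to the points
   of the Baer subline B (V not on the line containing B). *)
Definition baer_pencil (q : nat) (V : 'rV[F]_3) (B : {set 'rV[F]_3}) : Prop :=
  ppoint V /\ baer_subline q B /\
  ~~ [exists l, [&& pline l, on V l & [forall X in B, on X l]]].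

Definition on_pencil (V : 'rV[F]_3) (B : {set 'rV[F]_3}) (K : {set 'rV[F]_3}) : Prop :=
  forall Q, Q \in K -> exists X, X \in B /\
     exists l, [&& pline l, on V l, on X l & on Q l].

Definition unital (q : nat) (alpha beta : F) : {set 'rV[F]_3} :=
  [set v | ppoint v &&
     ([exists x : F, exists r : F, inFq q r &&
         prop v (vec3 x (alpha * x ^+ 2 + beta * x ^+ q.+1 + r) 1)]
      || prop v (vec3 0 1 0))].

End PG2.

(* Main.v *)
(* Write x' for x^q, Tr and N for the trace and norm to F_q, c = beta - beta' and P = (x0, y0).
   The tangent at (x1, y1) has slope 2 alpha x1 + c x1', so (x0 + u, y1) is a foot of P iff
   [qform u = ka], where qform u = alpha u^2 - alpha' u'^2 + c u u' and [ka] is a nonzero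
   constant with ka' = - ka.  Since d = dl^2 with dl' = - dl, [qform] is a constant times the
   norm of an F_q-linear bijection; so it is anisotropic and there are q + 1 feet.  In the
   coordinate u and a sheared second coordinate the feet are the (u, Tr (alpha u^2)), hence
   they lie on the horizontal lines of height t in F_q: a Baer pencil.

   A line off the vertex reduces to a quadratic equation over F_q.  On the line of height t
   the feet satisfy a quadratic equation in u^2, and they come in pairs u, -u.  Two distinct
   pairs at the same height make N alpha a square in F_q, hence alpha a square.  Conversely, if
   alpha is a square then Tr (alpha u^2) and [qform] are preserved by a common reflection, and
   all but at most 4 feet lie in an orbit of size 4 under it and -1. *)

Require Import Defs.
From HB Require Import structures.
From mathcomp Require Import all_boot all_order all_algebra all_field.
From mathcomp Require Import ring zify.
Set Implicit Arguments. Unset Strict Implicit. Unset Printing Implicit Defensive.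
Import GRing.Theory.
Local Open Scope ring_scope.

(** * Normalized homogeneous coordinates and affine points *)

Section Coordinates.
Variable F : finFieldType.
Implicit Types (u v l : 'rV[F]_3).

Lemma ord3P (i : 'I_3) : [\/ i = 0, i = 1 | i = 2%:R].
Proof.
by case: i => [[|[|[|]]] hi] //; [constructor 1|constructor 2|constructor 3]; apply: val_inj.
Qed.

Lemma vec3_eta v : v = vec3 (v 0 0) (v 0 1) (v 0 2%:R).
Proof. by apply/rowP => j; rewrite mxE; case: (ord3P j) => ->. Qed.

Lemma vec3_inj (a b c a' b' c' : F) :
  vec3 a b c = vec3 a' b' c' -> [/\ a = a', b = b' & c = c'].
Proof.
by move=> /rowP E; split; [move: (E 0)|move: (E 1)|move: (E 2%:R)]; rewrite !mxE.
Qed.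

Lemma scale_vec3 (k a b c : F) : k *: vec3 a b c = vec3 (k * a) (k * b) (k * c).
Proof. by apply/rowP => j; rewrite !mxE; case: (ord3P j) => ->. Qed.

Lemma vec3_eq0 (a b c : F) : (vec3 a b c == 0) = [&& a == 0, b == 0 & c == 0].
Proof.
apply/eqP/and3P => [|[/eqP-> /eqP-> /eqP->]].
  have -> : 0 = vec3 0 0 0 :> 'rV[F]_3 by apply/rowP => j; rewrite !mxE; case: (ord3P j) => ->.
  by move/vec3_inj => [-> -> ->].
by apply/rowP => j; rewrite !mxE; case: (ord3P j) => ->.
Qed.

Lemma on_vec3 (a b c a' b' c' : F) :
  on (vec3 a b c) (vec3 a' b' c') = (a * a' + b * b' + c * c' == 0).
Proof. by rewrite /on !mxE !big_ord_recl big_ord0 !mxE /= addr0 addrA. Qed.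

Lemma normalized_vec3 (a b c : F) :
  normalized (vec3 a b c) = [|| a == 1, (a == 0) && (b == 1) | [&& a == 0, b == 0 & c == 1]].
Proof.
apply/existsP/or3P.
  case=> i; rewrite mxE => /andP[vi /forallP h].
  case: (ord3P i) vi h => -> /= vi h; [constructor 1|constructor 2|constructor 3] => //.
    by rewrite vi andbT; move: (h 0); rewrite mxE.
  by rewrite vi andbT; move: (h 0) (h 1); rewrite !mxE /= => -> ->.
case=> [a1|/andP[a0 b1]|/and3P[a0 b0 c1]]; [exists 0|exists 1|exists 2%:R];
  rewrite mxE /= ?a1 ?b1 ?c1 /=; apply/forallP => j; rewrite ?mxE;
  by case: (ord3P j) => jE; rewrite ?jE //= ?a0 ?b0.
Qed.

Lemma on_scalel (k : F) v l : k != 0 -> on (k *: v) l = on v l.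
Proof. by move=> k0; rewrite /on -scalemxAl mxE mulf_eq0 (negPf k0). Qed.

Lemma on_scaler (k : F) v l : k != 0 -> on v (k *: l) = on v l.
Proof. by move=> k0; rewrite /on linearZ -scalemxAr mxE mulf_eq0 (negPf k0). Qed.

Lemma normalized_neq0 v : normalized v -> v != 0.
Proof.
case/existsP => i /andP[/eqP vi _]; apply/eqP => v0.
by move/eqP: vi; rewrite v0 mxE eq_sym oner_eq0.
Qed.

Lemma normalized_scale (k : F) v : normalized v -> normalized (k *: v) -> k = 1.
Proof.
rewrite (vec3_eta v) scale_vec3 !normalized_vec3.
case/or3P => [/eqP->|/andP[/eqP-> /eqP->]|/and3P[/eqP-> /eqP-> /eqP->]].
- rewrite mulr1; case/or3P => [/eqP //|/andP[/eqP k0]|/and3P[/eqP k0 _]];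
  by rewrite k0 mul0r eq_sym oner_eq0.
- rewrite mulr1 mulr0 eqxx eq_sym oner_eq0 /=; case/orP => [/eqP //|/andP[/eqP k0]].
  by rewrite k0 mul0r eq_sym oner_eq0.
- by rewrite mulr1 !mulr0 eqxx eq_sym oner_eq0 /= => /eqP.
Qed.

Definition pivot v : F :=
  if v 0 0 != 0 then v 0 0 else if v 0 1 != 0 then v 0 1 else v 0 2%:R.

Definition nrm v := (pivot v)^-1 *: v.

Lemma pivot_neq0 v : v != 0 -> pivot v != 0.
Proof.
rewrite {1}(vec3_eta v) vec3_eq0 /pivot.
by case: eqVneq => [_|->] //=; case: eqVneq => [_|->].
Qed.

Lemma nrm_normalized v : v != 0 -> normalized (nrm v).
Proof.
move/pivot_neq0; rewrite /nrm (vec3_eta v) /pivot scale_vec3 !mxE /= normalized_vec3.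
move: (v 0 0) (v 0 1) (v 0 2%:R) => x y z.
case: (eqVneq x 0) => [->|x0 _] /=; last by rewrite mulVf ?eqxx.
case: (eqVneq y 0) => [->|y0 _] /=; last by rewrite mulr0 mulVf ?eqxx ?orbT.
by move=> z0; rewrite !mulr0 mulVf ?eqxx ?orbT.
Qed.

Lemma on_nrml v l : v != 0 -> on (nrm v) l = on v l.
Proof. by move=> v0; rewrite on_scalel // invr_eq0 pivot_neq0. Qed.

Lemma on_nrmr v l : l != 0 -> on v (nrm l) = on v l.
Proof. by move=> v0; rewrite on_scaler // invr_eq0 pivot_neq0. Qed.

(** Uniqueness of the normalized representative turns proportionality into an equation. *)
Lemma prop_nrm u v : v != 0 -> ppoint u -> prop u v = (u == nrm v).
Proof.
move=> v0 nu; have p0 := pivot_neq0 v0; apply/existsP/eqP => [[k /andP[k0 /eqP uE]]|->].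
  have uk : u = (k * pivot v) *: nrm v by rewrite /nrm scalerA mulfK.
  by move: (nu); rewrite uk => /(normalized_scale (nrm_normalized v0)) ->; rewrite scale1r.
by exists (pivot v)^-1; rewrite invr_eq0 p0 eqxx.
Qed.

(** The rescaling is there because normalization looks at the first nonzero coordinate, whereas
    affine coordinates make the last one 1. *)
Definition aff (x y : F) := nrm (vec3 x y 1).

Lemma vec3_1_neq0 (x y : F) : vec3 x y 1 != 0.
Proof. by rewrite vec3_eq0 oner_eq0 !andbF. Qed.
Hint Resolve vec3_1_neq0 : core.

Lemma aff_ppoint x y : ppoint (aff x y).
Proof. exact: nrm_normalized. Qed.

Lemma on_aff (x y a b c : F) : on (aff x y) (vec3 a b c) = (x * a + y * b + c == 0).
Proof. by rewrite on_nrml // on_vec3 mul1r. Qed.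

Lemma aff_inj (x y x' y' : F) : aff x y = aff x' y' -> x = x' /\ y = y'.
Proof.
move=> E; have := on_aff x y 1 0 (- x'); have := on_aff x y 0 1 (- y').
rewrite E !on_aff !mulr1 !mulr0 !addr0 !add0r !subrr eqxx => /esym + /esym.
by rewrite !subr_eq0 => /eqP -> /eqP ->.
Qed.

Lemma aff_finite x y : ~~ on (aff x y) (linf F).
Proof. by rewrite on_aff !mulr0 !add0r oner_eq0. Qed.

Lemma finite_ppointP v : ppoint v -> ~~ on v (linf F) -> exists x y, v = aff x y.
Proof.
move=> nv; rewrite (vec3_eta v) on_vec3 !mulr0 !add0r mulr1 -vec3_eta => c0.
exists (v 0 0 / v 0 2%:R), (v 0 1 / v 0 2%:R); apply/eqP; rewrite -prop_nrm //.
apply/existsP; exists (v 0 2%:R); rewrite c0 scale_vec3 {1}(vec3_eta v).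
by rewrite ![v 0 2%:R * (_ / _)]mulrCA divff // !mulr1 eqxx.
Qed.

Lemma vec010_ppoint : ppoint (vec3 (0 : F) 1 0).
Proof. by rewrite /ppoint normalized_vec3 !eqxx orbT. Qed.

(** * Affine points of the unital *)

Section Unital.
Variables (q : nat) (a b : F).

Lemma vec010_unital : vec3 0 1 0 \in unital q a b.
Proof.
rewrite in_set vec010_ppoint; apply/orP; right; apply/existsP; exists 1.
by rewrite oner_eq0 scale1r eqxx.
Qed.

Lemma aff_unital (x y : F) :
  (aff x y \in unital q a b) = inFq q (y - (a * x ^+ 2 + b * x ^+ q.+1)).
Proof.
rewrite in_set aff_ppoint /=; apply/orP/idP => [[]|yFq].
- case/existsP => x' /existsP[r /andP[rFq]].
  rewrite prop_nrm ?aff_ppoint // => /eqP/aff_inj[-> ->].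
  by rewrite addrAC subrr add0r.
- case/existsP => k /andP[k0 /eqP E]; have := aff_finite x y.
  by rewrite E on_scalel // on_vec3 !mulr0 mul0r !addr0 eqxx.
- left; apply/existsP; exists x; apply/existsP; exists (y - (a * x ^+ 2 + b * x ^+ q.+1)).
  by rewrite yFq prop_nrm ?aff_ppoint // addrC subrK eqxx.
Qed.

Lemma unitalP v : v \in unital q a b -> v = vec3 0 1 0 \/ exists x y, v = aff x y.
Proof.
rewrite in_set => /andP[nv /orP[|]].
  case/existsP => x /existsP[r /andP[_]]; rewrite prop_nrm // => /eqP ->.
  by right; eexists; eexists; reflexivity.
case/existsP => k /andP[k0 /eqP E]; left.
by move: nv; rewrite /ppoint E => /(normalized_scale vec010_ppoint) ->; rewrite scale1r.
Qed.

End Unital.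
End Coordinates.

(** * Powers of Frobenius and root counting *)

(** Iterated Frobenius; it supplies conjugation [cj] as a ring morphism, so that the [rmorph] rules
    compute it. *)
Lemma expn_pchar_rmorphism (R : comNzRingType) (p k : nat) :
  p \in [pchar R] -> exists f : {rmorphism R -> R}, forall x, f x = x ^+ (p ^ k).
Proof.
move=> pR; elim: k => [|k [f fE]]; first by exists idfun => x; rewrite expn0 expr1.
by exists (f \o pFrobenius_aut pR)%FUN => x /=; rewrite fE pFrobenius_autE -exprM expnS.
Qed.

Lemma card_root_le (F : finFieldType) (p : {poly F}) (A : {set F}) n :
  p != 0 -> (size p <= n.+1)%N -> (forall x, x \in A -> root p x) -> (#|A| <= n)%N.
Proof.
move=> p0 sp Ap; rewrite cardE -ltnS; apply: leq_trans sp.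
apply: max_poly_roots => //; last exact: enum_uniq.
by apply/allP => x; rewrite mem_enum; exact: Ap.
Qed.

Lemma card_roots_Poly (F : finFieldType) (s : seq F) (A : {set F}) n :
  (size s <= n.+1)%N -> s`_n != 0 -> (forall x, x \in A -> (Poly s).[x] = 0) -> (#|A| <= n)%N.
Proof.
move=> ss sn As; apply: (@card_root_le _ (Poly s)).
- by apply: contraNneq sn => s0; rewrite -coef_Poly s0 coef0.
- exact: leq_trans (size_Poly _) ss.
- by move=> x /As /rootP.
Qed.

(* ['X^n - a] divides ['X^#|F| - 'X], hence splits with simple roots. *)
Lemma card_nth_roots (F : finFieldType) (n m : nat) (a : F) :
  (n * m)%N = #|F|.-1 -> a ^+ m = 1 -> #|[set x : F | x ^+ n == a]| = n.
Proof.
move=> nm am1.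
have F1 : (1 < #|F|)%N by exact: finNzRing_gt1.
have n0 : (0 < n)%N by rewrite lt0n; apply/eqP => n0; move: nm; rewrite n0 mul0n; lia.
have := @dvdp_prod_XsubC F F (index_enum F) id ('X^n - a%:P).
rewrite -finField_genPoly => /(_ _)[|s ps].
  have -> : 'X^#|F| - 'X = (('X^n) ^+ m - a%:P ^+ m) * 'X :> {poly F}.
    rewrite -polyC_exp am1 -exprM nm mulrBl mul1r -exprSr prednK //; lia.
  by rewrite dvdp_mulr // subrXX dvdp_mulr.
have um : uniq (mask s (index_enum F)) by rewrite mask_uniq // index_enum_uniq.
have -> : [set x : F | x ^+ n == a] = [set x in mask s (index_enum F)].
  apply/setP => x; rewrite !inE.
  have := eqp_root ps x; rewrite root_prod_XsubC => <-.
  by rewrite rootE !hornerE subr_eq0.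
rewrite cardsE (card_uniqP um).
have := eqp_size ps; rewrite size_prod_XsubC size_XnsubC //.
by case.
Qed.

(** * Conjugation, norms and squares over the subfield F_q *)

Section QuadraticExtension.
Variables (F : finFieldType) (q : nat) (cj : {rmorphism F -> F}).
Hypothesis cjE : forall x, cj x = x ^+ q.
Hypothesis cardF : #|F| = (q ^ 2)%N.
Hypothesis two_neq0 : 2%:R != 0 :> F.
Hypothesis oddq : odd q.

Lemma cjK : involutive cj.
Proof. by move=> x; rewrite !cjE -exprM mulnn -cardF expf_card. Qed.

Lemma q_gt1 : (1 < q)%N.
Proof.
have: (1 < #|F|)%N by exact: finNzRing_gt1.
by rewrite cardF; case: q => [|[|]].
Qed.

Lemma cardF_pred : ((q - 1) * (q + 1))%N = #|F|.-1.
Proof. have := q_gt1; rewrite cardF; nia. Qed.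

Lemma cj_fixed_expr x : x != 0 -> cj x = x -> x ^+ (q - 1) = 1.
Proof.
move=> x0 xx; apply: (mulIf x0).
by rewrite mul1r -exprSr -{2}xx cjE; congr (_ ^+ _); have := q_gt1; lia.
Qed.

(** Euler's criterion, by counting the roots of X^2 - x. *)
Lemma sqr_of_expr (x : F) m : (2 * m)%N = #|F|.-1 -> x ^+ m = 1 -> exists y, y ^+ 2 = x.
Proof.
move=> hm xm; have := card_nth_roots hm xm.
case: (set_0Vmem [set y | y ^+ 2 == x]) => [->|[y]]; first by rewrite cards0.
by rewrite inE => /eqP; exists y.
Qed.

(** The Euler exponent (q^2-1)/2 is a multiple of q - 1, which kills the nonzero elements of F_q. *)
Lemma cj_fixed_sqr x : cj x = x -> exists y, y ^+ 2 = x.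
Proof.
have [->|x0] := eqVneq x 0; first by exists 0; rewrite expr0n.
move=> xx; apply: (@sqr_of_expr _ ((q - 1) * (q + 1)./2)).
  by rewrite mulnCA mul2n -cardF_pred; congr (_ * _)%N; lia.
by rewrite exprM cj_fixed_expr // expr1n.
Qed.

(** Raising [x] to the power (q+1)(q-1)/2 gives the norm to the power (q-1)/2, that is, [y] to the
    power q - 1, which is 1. *)
Lemma norm_sqr x y : x != 0 -> cj y = y -> x * cj x = y ^+ 2 -> exists z, z ^+ 2 = x.
Proof.
move=> x0 yy xy.
have y0 : y != 0.
  by rewrite -sqrf_eq0 -xy mulf_neq0 // fmorph_eq0.
apply: (@sqr_of_expr _ ((q + 1) * (q - 1)./2)).
  by rewrite mulnCA mul2n mulnC -cardF_pred; congr (_ * _)%N; lia.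
rewrite exprM addn1 exprS -cjE xy -exprM mul2n halfK.
by have -> : odd (q - 1) = false; [lia | rewrite subn0 cj_fixed_expr].
Qed.

Lemma card_norm a : a != 0 -> cj a = a -> #|[set x | x * cj x == a]| = (q + 1)%N.
Proof.
move=> a0 aa; rewrite -(@card_nth_roots _ (q + 1) (q - 1) a).
- by apply: eq_card => x; rewrite !inE cjE -exprS addn1.
- by rewrite mulnC cardF_pred.
- exact: cj_fixed_expr.
Qed.

(** A root exists in F and conjugation can only change its sign; fixing it would make [d] a square
    in F_q. *)
Lemma nonsquare_cj_fixed d : cj d = d -> ~ (exists y, cj y = y /\ y ^+ 2 = d) ->
  exists2 dl, dl ^+ 2 = d & cj dl = - dl.
Proof.
move=> dd nd; have [y yd] := cj_fixed_sqr dd; exists y => //.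
have : (cj y) ^+ 2 == y ^+ 2 by rewrite -rmorphXn yd dd.
rewrite eqf_sqr => /orP[|] /eqP // cy.
by case: nd; exists y.
Qed.

Lemma cj_neq_opp (x : F) : cj x = x -> cj x = - x -> x = 0.
Proof.
move=> -> /eqP; rewrite -addr_eq0 -mulr2n -mulr_natl mulf_eq0 (negPf two_neq0).
by move/eqP.
Qed.

Lemma four_neq0 : 4%:R != 0 :> F.
Proof. by rewrite -[4%:R]/((2 ^ 2)%:R) natrX expf_neq0. Qed.

Lemma mul_nat2_neq0 (x : F) n : x != 0 -> (2 ^ n)%:R * x != 0.
Proof. by move=> x0; rewrite mulf_neq0 // natrX expf_neq0. Qed.

(** * The anisotropic form [qform] and its conic *)

Variables (a c dl ka : F).
Hypothesis a_neq0 : a != 0.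
Hypothesis cjc : cj c = - c.
Hypothesis dl2 : dl ^+ 2 = c ^+ 2 + 4%:R * (a * cj a).
Hypothesis cjdl : cj dl = - dl.
Hypothesis dl_neq0 : dl != 0.
Hypothesis cjka : cj ka = - ka.
Hypothesis ka_neq0 : ka != 0.

(** For [c = b - cj b] this is [z - cj z] with [z = a u^2 + b u cj u], the quadratic part of the
    equation of the unital. *)
Definition qform u := a * u ^+ 2 - cj a * cj u ^+ 2 + c * (u * cj u).
Definition level u := a * u ^+ 2 + cj a * cj u ^+ 2.
Definition conic := [set u | qform u == ka].

Let cja_neq0 : cj a != 0. Proof. by rewrite fmorph_eq0. Qed.
Let cjS := (rmorphD, rmorphM, rmorphXn, rmorphN, rmorphB, rmorph_nat, rmorph1, rmorph0, cjK, cjc, cjdl, cjka).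

(** As a binary form in [u] and [cj u], [qform] has discriminant [dl^2], so it splits into
    [2 a u + (c + dl) cj u] and [2 a u + (c - dl) cj u]; up to a constant the second factor is the
    conjugate of the first. *)
Lemma qform_norm u : let v := 2%:R * a * u + (c + dl) * cj u in
  8%:R * (a * cj a) * qform u = (c - dl) * (v * cj v).
Proof.
rewrite /qform !cjS.
by ring: dl2.
Qed.

Lemma c_neq_dl : c - dl != 0.
Proof.
apply: contraNneq (mul_nat2_neq0 2 (mulf_neq0 a_neq0 cja_neq0)) => cd.
have -> : (2 ^ 2)%:R * (a * cj a) = - ((c - dl) * (c + dl)) by ring: dl2.
by rewrite cd mul0r oppr0.
Qed.

(** The linear factor and its conjugate both vanish: a linear system in [u] and [cj u] with nonzero
    determinant [2 dl (c + dl)]. *)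
Lemma qform_eq0 u : qform u = 0 -> u = 0.
Proof.
move=> qu; have := qform_norm u; rewrite qu mulr0 => /esym/eqP.
rewrite mulf_eq0 (negPf c_neq_dl) /= mulf_eq0 fmorph_eq0 orbb => /eqP X0.
have Xc0 : 2%:R * cj a * cj u - (c + dl) * u = 0.
  by move/(congr1 cj): X0; rewrite !cjS => <-; ring.
have : 2%:R * dl * (c + dl) * (u * cj u) = 0.
  rewrite -(mul0r (2%:R * cj a * cj u)) -X0 -[RHS]subr0 -(mulr0 ((c + dl) * cj u)) -Xc0.
  by ring: dl2.
move/eqP; rewrite !mulf_eq0 fmorph_eq0 orbb (negPf two_neq0) (negPf dl_neq0) /=.
case/orP => /eqP // cd0.
have /eqP : 4%:R * (a * cj a) = - ((c - dl) * (c + dl)) by ring: dl2.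
rewrite cd0 mulr0 oppr0 -[4%:R]/((2 ^ 2)%:R) => /negPn.
by rewrite (mul_nat2_neq0 2 (mulf_neq0 a_neq0 cja_neq0)).
Qed.

(** The additive map [L] has trivial kernel by anisotropy, so it carries the conic bijectively onto
    a norm fibre. *)
Lemma card_conic : #|conic| = (q + 1)%N.
Proof.
pose L u := 2%:R * a * u + (c + dl) * cj u.
have Linj : injective L.
  move=> u v Luv; apply/eqP; rewrite -subr_eq0; apply/eqP/qform_eq0.
  have := qform_norm (u - v).
  have -> : 2%:R * a * (u - v) + (c + dl) * cj (u - v) = 0.
    by rewrite -[RHS](subrr (L u)) {2}Luv /L cjS; ring.
  move=> /= /eqP; rewrite mul0r mulr0 mulf_eq0 => /orP[/negPn|/eqP //].
  by rewrite (mul_nat2_neq0 3 (mulf_neq0 a_neq0 cja_neq0)).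
(* The norm of [L u] on the conic; it lies in F_q because conjugation negates both [ka] and
   [c - dl]. *)
pose b := 8%:R * (a * cj a) * ka / (c - dl).
have n8 := mul_nat2_neq0 3 (mulf_neq0 a_neq0 cja_neq0).
have b0 : b != 0 by rewrite (mulf_neq0 (mulf_neq0 n8 ka_neq0)) // invr_eq0 c_neq_dl.
have cjb : cj b = b.
  apply/eqP; rewrite /b fmorph_div.
  have cd' : cj (c - dl) = - (c - dl) by rewrite !cjS; ring.
  by rewrite cd' !cjS invrN; apply/eqP; ring.
rewrite -(card_norm b0 cjb); set N := [set _ | _].
have <- : #|L @^-1: N| = #|N| by apply/on_card_preimset/onW_bij/injF_bij.
apply: eq_card => u; rewrite !inE.
rewrite -[LHS](inj_eq (mulfI n8)) (qform_norm u) -[RHS](inj_eq (mulfI c_neq_dl)).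
by rewrite /b [X in _ = (_ == X)]mulrCA divff ?c_neq_dl // mulr1.
Qed.

Lemma conic_neq0 u : u \in conic -> u != 0.
Proof.
rewrite inE; apply: contraTneq => ->.
by rewrite /qform rmorph0 expr0n /= !mulr0 subr0 addr0 eq_sym.
Qed.

Lemma qformN u : qform (- u) = qform u.
Proof. by rewrite /qform rmorphN !sqrrN mulrNN. Qed.

Lemma conicN u : (- u \in conic) = (u \in conic).
Proof. by rewrite !in_set qformN. Qed.

Lemma levelN u : level (- u) = level u.
Proof. by rewrite /level rmorphN !sqrrN. Qed.

Lemma cj_level u : cj (level u) = level u.
Proof. by rewrite /level !cjS addrC. Qed.

(* Such a line reads [u = r * level u + s] with [level u] in F_q, so [qform u = ka]
   is a quadratic equation in [level u] with leading coefficient [qform r]. *)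
Lemma card_conic_line (m k e : F) : m != 0 ->
  (#|[set u in conic | (m * u + k * level u + e == 0)%R]| <= 2)%N.
Proof.
move=> m0; set A := [set _ in _ | _]; pose r := - k / m; pose s := - e / m.
have Au u : u \in A -> u = r * level u + s.
  rewrite inE => /andP[_ /eqP]; move: (level u) => t mkte; apply: (mulfI m0).
  by rewrite mulrDr !mulrA ![m * _ * _^-1]mulrAC divff // !mul1r -[LHS]subr0 -mkte; ring.
have [k0|k0] := eqVneq k 0.
  apply: (@leq_trans 1) => //; apply/card_le1_eqP => u v uA vA.
  by rewrite (Au u uA) (Au v vA) /r k0 oppr0 !mul0r.
have inj : {in A &, injective level} by move=> u v uA vA lv; rewrite (Au u uA) (Au v vA) lv.
rewrite -(card_in_imset inj).
apply: (@card_roots_Poly _ [:: qform s - ka;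
  2%:R * a * r * s - 2%:R * cj a * cj r * cj s + c * (r * cj s + s * cj r); qform r]) => //=.
  apply/eqP => /qform_eq0 /eqP; rewrite mulf_eq0 invr_eq0 (negPf m0) oppr_eq0.
  by rewrite (negPf k0).
move=> _ /imsetP[u uA ->]; have uE := Au u uA.
have cu : cj u = cj r * level u + cj s by rewrite {1}uE rmorphD rmorphM cj_level.
move: (level u) uE cu => t uE cu.
move: uA; rewrite !inE => /andP[/eqP uC _].
by rewrite !horner_cons hornerC -uC /qform cu uE; ring.
Qed.

(** * Level sets on the conic *)

(** Adding the two equations gives [c u cj u = ka + t - 2 a u^2]. Squaring and substituting
    [cj a cj u^2 = t - a u^2] leaves a quadratic in [u^2] with leading coefficient [(dl a)^2]. *)
Lemma card_conic_level (t : F) : (#|[set u in conic | level u == t]| <= 4)%N.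
Proof.
apply: (@card_roots_Poly _ [:: a * cj a * (ka + t) ^+ 2; 0;
  - (4%:R * (a * cj a) * (ka + t) + c ^+ 2 * t) * a; 0; (dl * a) ^+ 2]) => //=.
  by rewrite sqrf_eq0 mulf_neq0.
move=> u; rewrite !inE => /andP[/eqP uC /eqP <-].
by rewrite !horner_cons hornerC -uC /qform /level; ring: dl2.
Qed.

(** The fixed-point-free involution [u -> - u] preserves a level set, so a third point brings a
    fourth. *)
Lemma card_conic_level_neq3 (t : F) : #|[set u in conic | level u == t]| != 3%N.
Proof.
set A := [set _ in _ | _].
have AN u : u \in A -> - u \in A by rewrite in_set [- u \in A]in_set conicN levelN.
have nN u : u \in A -> - u != u.
  rewrite in_set => /andP[/conic_neq0 u0 _].
  by rewrite eq_sym -addr_eq0 -mulr2n -mulr_natl mulf_neq0.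
apply/eqP => A3; have /card_gt0P[u uA] : (0 < #|A|)%N by rewrite A3.
have /eqP/cards1P[v Av] : #|A :\ u :\ - u| = 1%N.
  move: A3; rewrite (cardsD1 u) uA (cardsD1 (- u)) !in_setD1 nN //= AN //=.
  by case.
have : v \in A :\ u :\ - u by rewrite Av set11.
rewrite !in_setD1 => /and3P[vNu vu vA].
suff : - v \in A :\ u :\ - u by rewrite Av in_set1 (negPf (nN v vA)).
by rewrite !in_setD1 eqr_opp vu AN // eqr_oppLR vNu.
Qed.

(** With [s = u + v], [w = u - v] and [A = s * cj w], subtracting the equations of [u] and [v]
    exhibits the norm of [a] as the square of [X dl / (2 (A - cj A))]. This lies in F_q since
    conjugation negates both [dl] and [A - cj A], so [norm_sqr] applies. *)
Lemma square_of_level_pair u v : u \in conic -> v \in conic -> level u = level v ->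
  u != v -> u != - v -> exists y, y ^+ 2 = a.
Proof.
rewrite !inE => /eqP uC /eqP vC lE uv uNv.
have s0 : u + v != 0 by rewrite addr_eq0.
have w0 : u - v != 0 by rewrite subr_eq0.
set s := u + v in s0; set w := u - v in w0.
pose A := s * cj w; pose X := A + cj A.
have cjX : cj X = X by rewrite /X rmorphD cjK addrC.
have aX : 4%:R * (a * s * w) = - (c * X).
  apply/eqP; rewrite -subr_eq0; apply/eqP.
  have -> : 4%:R * (a * s * w) - - (c * X) = 2%:R * ((qform u - qform v) + (level u - level v)).
    by rewrite /X /A /s /w /qform /level !cjS; ring.
  by rewrite uC vC lE; ring.
have caX : 4%:R * (cj a * cj s * cj w) = c * X.
  by move/(congr1 cj): aX; rewrite rmorphM rmorph_nat rmorphN 3!rmorphM cjX cjc mulNr opprK.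
(* [(A - cj A)^2 = X^2 - 4 A cj A], and [A cj A] is the norm of [s w], which [aX] and [caX] express
   through [X]. *)
have AX : (2%:R * (A - cj A)) ^+ 2 * (a * cj a) = (X * dl) ^+ 2.
  have -> : (2%:R * (A - cj A)) ^+ 2 * (a * cj a) = 4%:R * (a * cj a) * X ^+ 2
     - 4%:R * (a * s * w) * (4%:R * (cj a * cj s * cj w)).
    by rewrite /X /A !cjS; ring.
  by rewrite aX caX; ring: dl2.
have X0 : X != 0.
  apply: contraNneq (mul_nat2_neq0 2 (mulf_neq0 (mulf_neq0 a_neq0 s0) w0)) => X0.
  by rewrite -[(2 ^ 2)%:R]/(4%:R) aX X0 mulr0 oppr0.
have A0 : 2%:R * (A - cj A) != 0.
  apply: contraNneq (mulf_neq0 X0 dl_neq0) => A0; rewrite -sqrf_eq0 -AX A0.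
  by rewrite expr0n mul0r.
apply: (@norm_sqr _ (X * dl / (2%:R * (A - cj A)))) => //.
  rewrite fmorph_div rmorphM rmorphM rmorph_nat rmorphB cjK cjX cjdl.
  by rewrite -[cj A - A]opprB mulrN mulrN invrN mulrNN.
by rewrite exprMn exprVn -AX mulrAC divff ?mul1r // expf_neq0.
Qed.

Lemma card_conic_level_nonsquare (t : F) : ~ (exists y, y ^+ 2 = a) ->
  (#|[set u in conic | level u == t]| <= 2)%N.
Proof.
move=> nsq; set A := [set _ in _ | _].
have [->|[u]] := set_0Vmem A; first by rewrite cards0.
rewrite in_set => /andP[uC /eqP uT].
apply: leq_trans (_ : #|[set u; - u]| <= 2)%N; last by rewrite cards2; case: (_ == _).
apply/subset_leq_card/subsetP => v; rewrite in_set => /andP[vC /eqP vT].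
rewrite in_set2; apply/norP => -[vu vNu]; apply: nsq.
by apply: (@square_of_level_pair v u) => //; rewrite uT vT.
Qed.

(* The two forms [qform] and [level] are simultaneously diagonalizable over F_q when
   [a] is a square; [refl] is the reflection in a common orthogonal basis. *)
Definition refl mu u := mu / (2%:R * a) * (2%:R * a * u + c * cj u).

(** * A common symmetry of both forms, and level sets of size 4 *)

Section Reflection.
Variable mu : F.
Hypothesis cjmu : cj mu = - mu.
Hypothesis mu2 : dl ^+ 2 * mu ^+ 2 = 4%:R * (a * cj a).
Hypothesis c_neq0 : c != 0.

Lemma cj_refl u : cj (refl mu u) = - mu / (2%:R * cj a) * (2%:R * cj a * cj u - c * u).
Proof. by rewrite /refl rmorphM fmorph_div !cjS cjmu; congr (_ * _); ring. Qed.

Lemma level_refl u : level (refl mu u) = level u.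
Proof.
(* Only [mu^2] enters, and its value is known after multiplication by [dl^2]. *)
apply: (mulfI (expf_neq0 2 dl_neq0)).
rewrite /level cj_refl /refl.
have -> : dl ^+ 2 * (a * (mu / (2%:R * a) * (2%:R * a * u + c * cj u)) ^+ 2 +
   cj a * (- mu / (2%:R * cj a) * (2%:R * cj a * cj u - c * u)) ^+ 2) =
   dl ^+ 2 * mu ^+ 2 * ((2%:R * a * u + c * cj u) ^+ 2 / (4%:R * a)
     + (2%:R * cj a * cj u - c * u) ^+ 2 / (4%:R * cj a)).
  by field; rewrite ?two_neq0 ?four_neq0 ?a_neq0 ?cja_neq0.
rewrite mu2 dl2.
by field; rewrite ?two_neq0 ?four_neq0 ?a_neq0 ?cja_neq0.
Qed.

Lemma qform_refl u : qform (refl mu u) = qform u.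
Proof.
apply: (mulfI (expf_neq0 2 dl_neq0)).
rewrite /qform cj_refl /refl.
set x := 2%:R * a * u + _; set y := 2%:R * cj a * cj u - _.
have -> : dl ^+ 2 * (a * (mu / (2%:R * a) * x) ^+ 2 -
   cj a * (- mu / (2%:R * cj a) * y) ^+ 2 +
   c * (mu / (2%:R * a) * x * (- mu / (2%:R * cj a) * y))) =
   dl ^+ 2 * mu ^+ 2 * (x ^+ 2 / (4%:R * a)
     - y ^+ 2 / (4%:R * cj a) - c * x * y / (4%:R * (a * cj a))).
  by field; rewrite ?two_neq0 ?four_neq0 ?a_neq0 ?cja_neq0.
rewrite mu2 dl2 /x /y.
by field; rewrite ?two_neq0 ?four_neq0 ?a_neq0 ?cja_neq0.
Qed.

Lemma refl_conic u : (refl mu u \in conic) = (u \in conic).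
Proof. by rewrite !in_set qform_refl. Qed.

(** As [mu c] is nonzero, the eigenvalue equation makes [cj u] a fixed multiple [k u]; on the conic
    a constant times [u^2] then equals [ka]. *)
Lemma card_conic_eigen (e : F) : (#|[set u in conic | (refl mu u == e * u)%R]| <= 2)%N.
Proof.
have mu0 : mu != 0.
  apply: contraNneq (mulf_neq0 four_neq0 (mulf_neq0 a_neq0 cja_neq0)) => mu0.
  by rewrite -mu2 mu0 expr0n mulr0.
pose k := 2%:R * a * (e - mu) / (mu * c).
have cju u : refl mu u = e * u -> cj u = k * u.
  move=> eu; have -> : k * u = (2%:R * a * (e * u) - 2%:R * a * mu * u) / (mu * c).
    by rewrite /k; field; rewrite mu0 c_neq0.
  by rewrite -eu /refl; field; rewrite ?mu0 ?c_neq0 ?two_neq0 ?a_neq0.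
set A := [set _ in _ | _].
have Au u : u \in A -> (a - cj a * k ^+ 2 + c * k) * u ^+ 2 = ka.
  by rewrite !in_set => /andP[/eqP <- /eqP/cju uE]; rewrite /qform uE; ring.
have [->|[u /Au uA]] := set_0Vmem A; first by rewrite cards0.
apply: (@card_roots_Poly _ [:: - ka; 0; a - cj a * k ^+ 2 + c * k]) => //=.
  by apply: contraNneq ka_neq0 => K0; rewrite -uA K0 mul0r.
by move=> v /Au <-; rewrite !horner_cons hornerC; ring.
Qed.

(** The orbit of [u] under negation and [refl mu] has four elements and stays in the level set,
    which attains the bound 4. *)
Lemma card_level_generic u : u \in conic -> refl mu u != u -> refl mu u != - u ->
  #|[set v in conic | level v == level u]| = 4%N.
Proof.
move=> uC ru rNu; apply/eqP; rewrite eqn_leq card_conic_level /=.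
have opp_neq v : v \in conic -> (v == - v) = false.
  by move=> /conic_neq0 v0; rewrite -addr_eq0 -mulr2n -mulr_natl mulf_eq0 (negPf two_neq0) (negPf v0).
set s := [:: u; - u; refl mu u; - refl mu u].
have us : uniq s.
  rewrite /s /= !inE !negb_or eqr_opp eqr_oppLR.
  have e1 : (u == refl mu u) = false by rewrite eq_sym (negPf ru).
  have e2 : (u == - refl mu u) = false by rewrite eq_sym eqr_oppLR (negPf rNu).
  by rewrite !opp_neq ?refl_conic // e1 e2.
rewrite -[4%N]/(size s) -(card_uniqP us).
apply/subset_leq_card/subsetP => v; rewrite [v \in [set _ in _ | _]]in_set /s 3!in_cons mem_seq1.
by case/or4P => /eqP ->; rewrite ?conicN ?refl_conic ?levelN ?level_refl eqxx uC.
Qed.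

(** Of the q + 1 points of the conic at most 2 + 2 are eigenvectors for 1 or -1. The others lie on
    levels of size 4, at most four on each. *)
Lemma card_level4 :
  (q - 3 <= 4 * #|[set t | #|[set u in conic | level u == t]| == 4]|)%N.
Proof.
set T4 := [set t | _].
pose E e := [set u in conic | refl mu u == e * u].
pose E2 := E 1 :|: E (-1); pose G := conic :\: E2.
have cE2 : (#|E2| <= 4)%N.
  by rewrite (leq_trans (leq_card_setU _ _)) // (leq_add (card_conic_eigen 1)) // card_conic_eigen.
have cG : (q - 3 <= #|G|)%N.
  have : (#|conic :&: E2| <= #|E2|)%N by rewrite subset_leq_card ?subsetIr.
  by move: card_conic cE2; rewrite -(cardsID E2 conic) -/G; lia.
apply: leq_trans cG _.
have GT u : u \in G -> level u \in T4.
  rewrite in_setD in_setU negb_or => /andP[/andP[]] + + uC.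
  rewrite ![u \in E _]in_set [_ \in T4]in_set uC /= mul1r mulN1r => ru rNu.
  by rewrite card_level_generic.
rewrite -sum1_card (partition_big level (mem T4)) //=.
apply: leq_trans (_ : \sum_(t in T4) 4 <= _)%N; last by rewrite sum_nat_const mulnC.
apply: leq_sum => t _; rewrite sum1_card; apply: leq_trans (card_conic_level t).
rewrite -[X in (X <= _)%N]cardsE; apply/subset_leq_card/subsetP => u.
rewrite in_set [u \in [set _ in _ | _]]in_set => /andP[+ ->].
by rewrite in_setD => /andP[_ ->].
Qed.

End Reflection.

(** If [c = 0], then [dl] is plus or minus twice the norm of [y]; it would be both fixed and negated
    by conjugation. *)
Lemma c_neq0_of_square : (exists y, y ^+ 2 = a) -> c != 0.
Proof.
case=> y ya; apply: contra_neq dl_neq0 => c0.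
have /eqP : dl ^+ 2 = (2%:R * (y * cj y)) ^+ 2 by rewrite dl2 c0 -ya rmorphXn; ring.
by rewrite eqf_sqr => /orP[] /eqP dlE; apply: cj_neq_opp => //; rewrite dlE !cjS; ring.
Qed.

(** For q = 3 every nonzero element negated by conjugation squares to -1; [c] and [dl] are such
    elements, so [4 a cj a = dl^2 - c^2] would vanish. *)
Lemma q_ge5_of_square : (exists y, y ^+ 2 = a) -> (5 <= q)%N.
Proof.
move=> /c_neq0_of_square c0; have q1 := q_gt1.
suff : q <> 3%N by lia.
move=> q3.
have sq1 x : x != 0 -> cj x = - x -> x ^+ 2 = -1.
  by move=> x0; rewrite cjE q3 => xE; apply: (mulfI x0); rewrite -exprS xE mulrN1.
have : 4%:R * (a * cj a) = dl ^+ 2 - c ^+ 2 by rewrite dl2 addrC addKr.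
rewrite !sq1 // subrr => /eqP.
by rewrite (negPf (mulf_neq0 four_neq0 (mulf_neq0 a_neq0 cja_neq0))).
Qed.

Lemma card_level4_of_square : (exists y, y ^+ 2 = a) ->
  (q - 3 <= 4 * #|[set t | #|[set u in conic | level u == t]| == 4]|)%N.
Proof.
move=> asq; have c0 := c_neq0_of_square asq; have [y ya] := asq.
(* The norm of [y] is a root of the norm of [a]; dividing by [dl] gives the sign change under
   conjugation. *)
apply: (@card_level4 (2%:R * (y * cj y) / dl)) => //.
  by rewrite fmorph_div !cjS invrN mulrN [y * _]mulrC.
by rewrite -ya rmorphXn; field; exact: dl_neq0.
Qed.

(** * Tangents of the unital and the feet of [P] *)

Section Pedal.
Variables b x0 y0 : F.
Hypothesis cE : c = b - cj b.

(** Its zeros are the affine points of the unital: it vanishes when the parameter r is in F_q. *)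
Definition offset x y :=
  y - (a * x ^+ 2 + b * (x * cj x)) - cj (y - (a * x ^+ 2 + b * (x * cj x))).

Hypothesis kaE : offset x0 y0 = - ka.

Local Notation U := (unital q a b).
Local Notation P := (aff x0 y0).

Lemma aff_unital_offset x y : (aff x y \in U) = (offset x y == 0).
Proof. by rewrite aff_unital /inFq -cjE /offset [x ^+ q.+1]exprS -cjE -subr_eq0 -opprB oppr_eq0. Qed.

Definition slope x := 2%:R * a * x + c * cj x.

(** Taylor expansion along a line of slope [m]: for [m = slope x] the linear term disappears and the
    anisotropic [qform] remains, which gives tangency. *)
Lemma offset_shift x y m u : offset (x + u) (y + m * u) =
  offset x y + ((m - slope x) * u - cj ((m - slope x) * u)) - qform u.
Proof. by rewrite /offset /slope /qform !cjS cE; ring. Qed.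

(** After the shear by [slope x0], the height is [level u], an element of F_q, up to the translation
    by [y0 + ka]. *)
Definition foot u := aff (x0 + u) (y0 + slope x0 * u + level u + ka).

(** On the conic [level u + ka = 2 a u^2 + c u cj u], which is the change of slope from [x0] to
    [x0 + u], times [u]. *)
Lemma foot_tangent u : u \in conic -> foot u = aff (x0 + u) (y0 + slope (x0 + u) * u).
Proof.
rewrite in_set /foot /qform /level /slope => /eqP <-.
by congr aff; rewrite cjS; ring.
Qed.

Lemma foot_inj : injective foot.
Proof. by move=> u v /aff_inj[/addrI]. Qed.

Lemma tangent_uniq l (Q R : 'rV[F]_3) : tangent U l -> Q \in U -> R \in U ->
  on Q l -> on R l -> Q = R.
Proof.
move=> /andP[_ /cards1P[S US]] QU RU Ql Rl.
have : Q \in [set v in U | on v l] by rewrite in_set QU.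
have : R \in [set v in U | on v l] by rewrite in_set RU.
by rewrite US !in_set1 => /eqP -> /eqP ->.
Qed.

Lemma vec010_neq_aff x y : vec3 0 1 0 <> aff x y :> 'rV[F]_3.
Proof. by move=> E; have := aff_finite x y; rewrite -E on_vec3 !mulr0 mul0r !addr0 eqxx. Qed.

(** A vertical line through [P] meets the unital at infinity and again at the affine point over [x0]
    with r = 0. *)
Lemma tangent_not_vertical l : tangent U l -> on P l -> l 0 1 != 0.
Proof.
move=> tl; rewrite (vec3_eta l) on_aff mxE /= => Pl; apply/eqP => l1.
apply: (@vec010_neq_aff x0 (a * x0 ^+ 2 + b * (x0 * cj x0))).
apply: (tangent_uniq tl); rewrite ?vec010_unital // ?aff_unital_offset.
- by rewrite /offset subrr rmorph0 subr0.
- by rewrite (vec3_eta l) on_vec3 l1 !mul0r mulr0 !addr0 eqxx.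
- by rewrite (vec3_eta l) on_aff l1; move: Pl; rewrite l1 !mulr0.
Qed.

Lemma cj_qform u : cj (qform u) = - qform u.
Proof. by rewrite /qform !cjS; ring. Qed.

(* If the slope [m] were wrong, with error [w], the line would meet the unital again at
   [x1 + t * (ka / w)], where [t] solves [t * 2 ka = t ^ 2 * qform (ka / w)]. *)
Lemma tangent_slope x1 y1 m : offset x1 y1 = 0 ->
  (forall u, offset (x1 + u) (y1 + m * u) = 0 -> u = 0) -> m = slope x1.
Proof.
move=> o1 uniq1; apply/eqP; rewrite -subr_eq0; apply: contraT => w0.
set w := m - slope x1 in w0.
have v0 : ka / w != 0 by rewrite mulf_neq0 ?invr_neq0.
have Q0 : qform (ka / w) != 0 by apply: contraNneq v0 => /qform_eq0 ->.
pose t := 2%:R * ka / qform (ka / w).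
have t0 : t != 0 by rewrite !mulf_neq0 ?invr_neq0.
have cjt : cj t = t by rewrite /t fmorph_div cj_qform !cjS mulrN invrN mulrNN.
have /eqP : t * (ka / w) = 0.
  apply: uniq1; rewrite offset_shift o1 -/w [w * _]mulrCA [w * _]mulrC divfK //.
  rewrite [cj (_ * _)]rmorphM /= cjt cjka /qform rmorphM /= cjt.
  have -> : 0 + (t * ka - t * - ka) - (a * (t * (ka / w)) ^+ 2 -
    cj a * (t * cj (ka / w)) ^+ 2 + c * (t * (ka / w) * (t * cj (ka / w))))
    = t * (2%:R * ka - t * qform (ka / w)) by rewrite /qform; ring.
  by rewrite /t divfK // subrr mulr0.
by rewrite (negPf (mulf_neq0 t0 v0)).
Qed.

(** Following the tangent at abscissa [x0 + u] back to [P], [offset_shift] gives the contact point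
    offset [qform u - ka]; it is on the unital exactly when [u] is on the conic. *)
Lemma pedal_foot : pedal U P = foot @: conic.
Proof.
apply/setP => Q; apply/idP/imsetP => [|[u uC ->]].
  rewrite in_set => /andP[QU /existsP[l /and3P[tl Pl Ql]]].
  have l1 := tangent_not_vertical tl Pl.
  have slopeE x y : on (aff x y) l -> forall u, on (aff (x + u) (y + - l 0 0 / l 0 1 * u)) l.
    rewrite (vec3_eta l) => + u; rewrite !on_aff => /eqP E; apply/eqP.
    by rewrite -E !mxE /=; field.
  case: (unitalP QU) Ql (QU) => [->|[x1 [y1 ->]]].
    by rewrite (vec3_eta l) on_vec3 !mul0r mul1r add0r addr0 (negPf l1).
  move=> Ql; rewrite aff_unital_offset => /eqP o1.
  set m := - l 0 0 / l 0 1 in slopeE.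
  have mE : m = slope x1.
    apply: (tangent_slope o1) => u ou; apply: (addrI x1); rewrite addr0.
    have /aff_inj[] // : aff (x1 + u) (y1 + m * u) = aff x1 y1.
    by apply: (tangent_uniq tl); rewrite ?aff_unital_offset ?ou ?o1 ?slopeE.
  have y1E : y1 = y0 + m * (x1 - x0).
    have := slopeE _ _ Pl (x1 - x0); rewrite [x0 + _]addrC subrK.
    move: Ql; rewrite (vec3_eta l) !on_aff => /eqP E /eqP E'.
    by apply: (mulIf l1); apply: (addrI (x1 * l 0 0)); apply: (addIr (l 0 2%:R)); rewrite E E'.
  have uC : x1 - x0 \in conic.
    have := offset_shift x1 y1 m (- (x1 - x0)).
    rewrite o1 mE subrr mul0r rmorph0 subrr addr0 -mE y1E mulrN subKr addrK kaE.
    by rewrite in_set add0r qformN => /oppr_inj ->.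
  by exists (x1 - x0); rewrite // foot_tangent // [x0 + _]addrC subrK -mE -y1E.
rewrite in_set; set x1 := x0 + u; set m := slope x1; pose y1 := y0 + m * u.
rewrite foot_tangent // -/x1 -/m -/y1.
have o1 : offset x1 y1 = 0.
  have := offset_shift x1 y1 m (- u); rewrite subrr mul0r rmorph0 subrr addr0.
  rewrite mulrN !addrK kaE; move: uC; rewrite -conicN in_set => /eqP ->.
  by move/eqP; rewrite eq_sym subr_eq addNr => /eqP.
rewrite aff_unital_offset o1 eqxx; apply/existsP; exists (nrm (vec3 m (-1) (y1 - m * x1))).
have l0 : vec3 m (-1) (y1 - m * x1) != 0 by rewrite vec3_eq0 oppr_eq0 oner_eq0 andbF.
have onE x y : on (aff x y) (nrm (vec3 m (-1) (y1 - m * x1))) = (y == y1 + m * (x - x1)).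
  by rewrite on_nrmr // on_aff -[RHS]subr_eq0 -[RHS]oppr_eq0; congr (_ == 0); ring.
rewrite !onE subrr mulr0 addr0 eqxx andbT; apply/andP; split; last first.
  by apply/eqP; rewrite /y1 /x1; ring.
rewrite /tangent /pline nrm_normalized //=; apply/cards1P; exists (aff x1 y1).
apply/setP => R; rewrite in_set in_set1; apply/andP/eqP => [[RU]|->]; last first.
  by rewrite aff_unital_offset o1 eqxx onE subrr mulr0 addr0.
case: (unitalP RU) (RU) => [->|[x [y ->]]].
  by rewrite on_nrmr // on_vec3 !mul0r mul1r add0r addr0 oppr_eq0 oner_eq0.
rewrite aff_unital_offset onE => + /eqP yE; rewrite yE.
(* Along this line the offset is [- qform (x - x1)], so anisotropy leaves only the contact point. *)
have := offset_shift x1 y1 m (x - x1); rewrite subrr mul0r rmorph0 subrr addr0 o1 add0r.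
rewrite [x1 + _]addrC subrK => -> /eqP/eqP; rewrite oppr_eq0 => /eqP/qform_eq0/eqP.
by rewrite subr_eq0 => /eqP ->; rewrite subrr mulr0 addr0.
Qed.

(** * Lines in the sheared coordinates and their intersection numbers *)

Implicit Types (l : 'rV[F]_3) (m k e t : F).

(** The point at infinity of the lines of slope [slope x0], which the shear makes horizontal. *)
Definition vertex := vec3 1 (slope x0) 0.

(** Coefficients chosen so that pulling the line back along [foot] gives
    [m u + k level u + e = 0]. *)
Definition lin m k e :=
  vec3 (m - k * slope x0) k (e - (m - k * slope x0) * x0 - k * (y0 + ka)).

Lemma on_foot u (l0 l1 l2 : F) : on (foot u) (vec3 l0 l1 l2) =
  ((l0 + l1 * slope x0) * u + l1 * level u + (l0 * x0 + l1 * (y0 + ka) + l2) == 0).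
Proof. by rewrite on_aff; congr (_ == 0); ring. Qed.

Lemma on_foot_lin u m k e : on (foot u) (lin m k e) = (m * u + k * level u + e == 0).
Proof. by rewrite on_foot; congr (_ == 0); ring. Qed.

Lemma on_vertex_lin m k e : on vertex (lin m k e) = (m == 0).
Proof. by rewrite on_vec3; congr (_ == 0); ring. Qed.

Lemma lin_neq0 m k e : (m != 0) || (k != 0) -> lin m k e != 0.
Proof.
rewrite vec3_eq0 -negb_and; apply: contra => /and3P[m0 /eqP k0 _].
by move: m0; rewrite k0 mul0r subr0 eqxx andbT.
Qed.

Lemma linP l : exists m k e, l = lin m k e.
Proof.
exists (l 0 0 + l 0 1 * slope x0), (l 0 1), (l 0 0 * x0 + l 0 1 * (y0 + ka) + l 0 2%:R).
by rewrite {1}(vec3_eta l) /lin; congr vec3; ring.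
Qed.

Lemma meet_scale (K : {set 'rV[F]_3}) (k : F) l : k != 0 -> meet K (k *: l) = meet K l.
Proof. by move=> k0; apply: eq_card => v; rewrite !in_set on_scaler. Qed.

Lemma meet_nrm (K : {set 'rV[F]_3}) l : l != 0 -> meet K (nrm l) = meet K l.
Proof. by move=> l0; rewrite meet_scale // invr_eq0 pivot_neq0. Qed.

Lemma meet_lin m k e : meet (pedal U P) (lin m k e) =
  #|[set u in conic | (m * u + k * level u + e == 0)%R]|.
Proof.
rewrite /meet pedal_foot -(card_imset _ foot_inj); congr #|pred_of_set _|.
apply/setP => v; rewrite in_set; apply/andP/imsetP => [[/imsetP[u uC ->]]|[u]].
  by rewrite on_foot_lin => E; exists u; rewrite // in_set uC.
by rewrite in_set => /andP[uC E] ->; rewrite on_foot_lin imset_f.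
Qed.

Lemma meet_lin_vertex k e : k != 0 ->
  meet (pedal U P) (lin 0 k e) = #|[set u in conic | level u == - e / k]|.
Proof.
move=> k0; rewrite meet_lin; apply: eq_card => u; rewrite !in_set; congr andb.
by rewrite mul0r add0r addr_eq0 -[RHS](inj_eq (mulfI k0)) [k * (_ / _)]mulrC divfK.
Qed.

Lemma meet_off_vertex l : ~~ on vertex l -> (meet (pedal U P) l <= 2)%N.
Proof. by have [m [k [e ->]]] := linP l; rewrite on_vertex_lin meet_lin; exact: card_conic_line. Qed.

Lemma meet_on_vertex l : l != 0 -> on vertex l -> meet (pedal U P) l = 0%N \/
  exists t, meet (pedal U P) l = #|[set u in conic | level u == t]|.
Proof.
have [m [k [e ->]]] := linP l; rewrite on_vertex_lin => + /eqP m0; rewrite m0.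
(* With [m = k = 0] this is the line at infinity, which contains no foot. *)
have [->|k0] := eqVneq k 0; last by right; eexists; exact: meet_lin_vertex.
move=> l0; have e0 : e != 0.
  by apply: contraNneq l0 => ->; rewrite /lin vec3_eq0 !(mul0r, subr0) !eqxx.
left; apply/eqP; rewrite meet_lin cards_eq0; apply/eqP/setP => u.
by rewrite in_set !mul0r !add0r (negPf e0) andbF in_set0.
Qed.

Lemma pedal_type : of_type (pedal U P) [:: 0; 1; 2; 4]%N.
Proof.
move=> l /normalized_neq0 l0; have [/(meet_on_vertex l0)[->//|[t ->]]|] := boolP (on vertex l).
  have := card_conic_level t; have := card_conic_level_neq3 t.
  by case: #|_| => [|[|[|[|[|]]]]].
by move/meet_off_vertex; case: meet => [|[|[|]]].
Qed.

Lemma pedal_arc : ~ (exists y, y ^+ 2 = a) -> is_arc (pedal U P).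
Proof.
move=> nsq l /normalized_neq0 l0.
have : (meet (pedal U P) l <= 2)%N.
  have [/(meet_on_vertex l0)[->//|[t ->]]|] := boolP (on vertex l).
    exact: card_conic_level_nonsquare.
  exact: meet_off_vertex.
by case: meet => [|[|[|]]].
Qed.

Lemma meet4_vertex l : meet (pedal U P) l = 4%N -> on vertex l.
Proof. by move=> l4; apply/contraT => /meet_off_vertex; rewrite l4. Qed.

(** Each level of size 4 gives a horizontal line, and any foot on that line recovers the level. *)
Lemma card_meet4 :
  (#|[set t : F | #|[set u in conic | level u == t]| == 4%N]| <=
   #|[set l | pline l && (meet (pedal U P) l == 4%N)]|)%N.
Proof.
have l0 t : lin 0 1 (- t) != 0 by rewrite lin_neq0 // oner_eq0 orbT.
have lE t : meet (pedal U P) (nrm (lin 0 1 (- t))) = #|[set u in conic | level u == t]|.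
  by rewrite meet_nrm // meet_lin_vertex ?oner_eq0 // opprK divr1.
rewrite -(card_in_imset (f := fun t => nrm (lin 0 1 (- t)))).
  apply/subset_leq_card/subsetP => _ /imsetP[t + ->].
  by rewrite !in_set lE /pline nrm_normalized.
move=> t t'; rewrite in_set => /eqP t4 _ tt'.
have /card_gt0P[u] : (0 < #|[set u in conic | level u == t]|)%N by rewrite t4.
rewrite in_set => /andP[_ /eqP ut].
have : on (foot u) (nrm (lin 0 1 (- t))) by rewrite on_nrmr // on_foot_lin ut mul0r add0r mul1r subrr.
by rewrite tt' on_nrmr // on_foot_lin ut mul0r add0r mul1r subr_eq0 => /eqP.
Qed.

Lemma pedal_class : (exists y, y ^+ 2 = a) -> of_class (pedal U P) [:: 0; 1; 2; 4]%N.
Proof.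
move=> asq; have q5 := q_ge5_of_square asq.
split; first exact: pedal_type.
have [u uC] : exists u, u \in conic by apply/card_gt0P; rewrite card_conic addn1.
suff wit m k e n : (m != 0) || (k != 0) -> #|[set u in conic | (m * u + k * level u + e == 0)%R]| = n ->
    exists l, pline l /\ meet (pedal U P) l = n.
  move=> n; rewrite !inE => /or4P[] /eqP ->.
  - exists (linf F); split; first by rewrite /pline /linf normalized_vec3 !eqxx !orbT.
    apply/eqP; rewrite cards_eq0; apply/eqP/setP => v; rewrite in_set in_set0 pedal_foot.
    by apply/andP => -[/imsetP[w _ ->]]; apply/negP/aff_finite.
  (* The vertical line through [foot u]. *)
  - apply: (wit 1 0 (- u)); first by rewrite oner_eq0.
    apply/eqP/cards1P; exists u; apply/setP => v; rewrite in_set in_set1 mul1r mul0r addr0.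
    by rewrite subr_eq0; case: eqVneq => [->|]; rewrite ?uC ?andbF.
  (* The conic has q + 1 > 4 points, so they cannot all share one level. *)
  - have [v vC uv] : exists2 v, v \in conic & level v != level u.
      have := card_conic_level (level u); case: (boolP [exists v in conic, level v != level u]).
        by case/exists_inP => v vC vu; exists v.
      move=> /exists_inPn all_eq; suff -> : [set w in conic | level w == level u] = conic.
        by rewrite card_conic; lia.
      by apply/setP => w; rewrite in_set; case: (boolP (w \in conic)) => // /all_eq; rewrite negbK.
    have m0 : level v - level u != 0 by rewrite subr_eq0.
    (* The join of [foot u] and [foot v]; it misses the vertex because the levels differ. *)
    apply: (wit (level v - level u) (u - v)
      (level u * v - level v * u)); first by rewrite m0.
    apply/eqP; rewrite eqn_leq card_conic_line //=.
    have nuv : u != v by apply: contraNneq uv => ->.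
    have <- : #|[set u; v]| = 2%N by rewrite cards2 nuv.
    apply/subset_leq_card/subsetP => w; rewrite in_set2.
    by case/orP => /eqP ->; rewrite in_set ?uC ?vC /=; apply/eqP; ring.
  - have /card_gt0P[l] : (0 < #|[set l | pline l && (meet (pedal U P) l == 4%N)]|)%N.
      apply: leq_trans card_meet4; have := card_level4_of_square asq.
      by case: #|_|; lia.
    by rewrite in_set => /andP[nl /eqP l4]; exists l.
move=> mk cn; exists (nrm (lin m k e)); have l0 := lin_neq0 e mk.
by rewrite /pline nrm_normalized // meet_nrm // meet_lin.
Qed.

(** * The Baer pencil *)

(** The first two rows are points of the line x = 0: its point at infinity and its intersection with
    the line of level 0. The third row completes them to a basis. *)
Definition base_mx : 'M[F]_3 := \matrix_(i < 3)
  [:: vec3 0 1 0; vec3 0 (y0 + ka - slope x0 * x0) 1; vec3 1 0 0]`_i.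

Definition base := [set v | ppoint v && [exists s : F, exists t : F,
  [&& inFq q s, inFq q t, (s != 0) || (t != 0) & prop v (vec3 s t 0 *m base_mx)]]].

Lemma mul_base_mx (s t r : F) : vec3 s t r *m base_mx =
  vec3 r (s + t * (y0 + ka - slope x0 * x0)) t.
Proof.
apply/rowP => j; rewrite !mxE !big_ord_recl big_ord0 !mxE /=.
by case: (ord3P j) => -> /=; ring.
Qed.

Lemma base_mx_unit : base_mx \in unitmx.
Proof.
rewrite -row_free_unit -kermx_eq0; apply/rowV0P => v /sub_kermxP.
rewrite (vec3_eta v) mul_base_mx => /eqP; rewrite vec3_eq0 => /and3P[/eqP r0 /eqP s0 /eqP t0].
by move: s0; rewrite r0 t0 mul0r addr0 => ->; apply/eqP; rewrite vec3_eq0 !eqxx.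
Qed.

Lemma inFq0 : inFq q (0 : F).
Proof. by rewrite /inFq -cjE rmorph0. Qed.

Lemma inFq1 : inFq q (1 : F).
Proof. by rewrite /inFq -cjE rmorph1. Qed.

Lemma aff_base (t : F) : inFq q t -> aff 0 (t + (y0 + ka - slope x0 * x0)) \in base.
Proof.
move=> tq; rewrite in_set aff_ppoint; apply/existsP; exists t; apply/existsP; exists 1.
by rewrite tq inFq1 oner_eq0 orbT mul_base_mx mul1r prop_nrm ?vec3_1_neq0 ?aff_ppoint ?eqxx.
Qed.

Lemma vec010_base : vec3 0 1 0 \in base.
Proof.
rewrite in_set vec010_ppoint; apply/existsP; exists 1; apply/existsP; exists 0.
rewrite inFq0 inFq1 oner_eq0 mul_base_mx mul0r addr0.
by apply/existsP; exists 1; rewrite oner_eq0 scale1r eqxx.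
Qed.

Lemma vertex_base_pencil : baer_pencil q vertex base.
Proof.
split; first by rewrite /ppoint normalized_vec3 eqxx.
split; first by exists base_mx; split; [exact: base_mx_unit|].
apply/existsP => -[l /and3P[nl Vl /forallP Bl]].
(* Two base points and the vertex are linearly independent, so a line through all three has zero
   coefficients. *)
have := Bl (vec3 0 1 0); have := Bl (aff 0 (0 + (y0 + ka - slope x0 * x0))).
rewrite aff_base ?inFq0 // vec010_base /=; move: nl Vl => /normalized_neq0.
rewrite (vec3_eta l) on_aff !on_vec3 !(mul0r, add0r, addr0, mul1r).
move=> l0 Vl l2 /eqP l1; move: l0 Vl l2.
by rewrite l1 !mulr0 !addr0 add0r vec3_eq0 eqxx => + Vl l2; rewrite Vl l2.
Qed.

Lemma pedal_on_pencil : on_pencil vertex base (pedal U P).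
Proof.
move=> Q; rewrite pedal_foot => /imsetP[u uC ->].
(* The point where the horizontal line of height [level u] meets x = 0. *)
exists (aff 0 (level u + (y0 + ka - slope x0 * x0))); split.
  by rewrite aff_base // /inFq -cjE cj_level.
exists (nrm (lin 0 1 (- level u))).
have l0 : lin 0 1 (- level u) != 0 by rewrite lin_neq0 // oner_eq0 orbT.
rewrite /pline nrm_normalized // !on_nrmr // on_vertex_lin on_foot_lin on_aff eqxx /=.
by apply/andP; split; apply/eqP; ring.
Qed.

End Pedal.
End QuadraticExtension.

Theorem theorem1p5 (F : finFieldType) (p k q : nat)
  (hp : prime p) (hpodd : odd p) (hk : (0 < k)%N) (hq : q = (p ^ k)%N)
  (hF : #|F| = (q ^ 2)%N)
  (alpha beta : F) (halpha : alpha != 0)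
  (hd : let d := (beta ^+ q - beta) ^+ 2 + 4%:R * alpha ^+ q.+1 in
        inFq q d /\ ~ (exists y : F, inFq q y /\ y ^+ 2 = d))
  (P : 'rV[F]_3) (hP : ppoint P) (hPU : P \notin unital q alpha beta)
  (hPinf : ~~ on P (linf F)) :
  exists V B,
    [/\ baer_pencil q V B, on V (linf F),
        on_pencil V B (pedal (unital q alpha beta) P),
        (~ (exists y : F, y ^+ 2 = alpha) ->
           is_arc (pedal (unital q alpha beta) P)) &
        ((exists y : F, y ^+ 2 = alpha) ->
           [/\ of_class (pedal (unital q alpha beta) P) [:: 0%N; 1%N; 2%N; 4%N],
               (q - 3 <= 4 * #|[set l | pline l &&
                    (meet (pedal (unital q alpha beta) P) l == 4%N)]|)%N &
               forall l, pline l -> meet (pedal (unital q alpha beta) P) l = 4%N ->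
                 on V l])].
Proof.
have pF : p \in [pchar F].
  by apply: (@card_finPcharP _ _ (k * 2)) => //; rewrite hF hq expnM.
have [cj cjE0] := expn_pchar_rmorphism k pF.
have cjE (x : F) : cj x = x ^+ q by rewrite cjE0 hq.
have two0 : 2%:R != 0 :> F.
  rewrite -(dvdn_pcharf pF); apply/negP => /(dvdn_leq (isT : (0 < 2)%N)).
  by have := prime_gt1 hp; lia.
have oddq : odd q by rewrite hq oddX hpodd orbT.
have cjK := cjK cjE hF.
move: hd => /=; rewrite [alpha ^+ _]exprS -!cjE; set d := _ + _ => -[/eqP dq dn].
have cjd : cj d = d by rewrite cjE.
have [dl dlE cjdl] : exists2 dl, dl ^+ 2 = d & cj dl = - dl.
  apply: (nonsquare_cj_fixed cjE hF two0 oddq cjd) => -[y [yq y2]]; apply: dn; exists y.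
  by rewrite /inFq -cjE yq.
have dl0 : dl != 0.
  apply/eqP => dl0; apply: dn; exists 0.
  by rewrite /inFq -cjE rmorph0 eqxx expr0n -dlE dl0 expr0n.
pose c := beta - cj beta.
have cjc : cj c = - c by rewrite /c rmorphB cjK opprB.
have dl2 : dl ^+ 2 = c ^+ 2 + 4%:R * (alpha * cj alpha) by rewrite dlE /d /c -sqrrN opprB.
have [x0 [y0 PE]] := finite_ppointP hP hPinf.
(* It is nonzero exactly because [P] is off the unital. *)
pose ka := - offset cj alpha beta x0 y0.
have ka0 : ka != 0.
  by move: hPU; rewrite oppr_eq0 PE (aff_unital_offset cjE).
have cjka : cj ka = - ka by rewrite /ka /offset rmorphN rmorphB cjK; ring.
have kaE : offset cj alpha beta x0 y0 = - ka by rewrite opprK.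
have cE : c = beta - cj beta by [].
rewrite PE; exists (vertex cj alpha c x0), (base q cj alpha c ka x0 y0).
split.
- exact: vertex_base_pencil.
- by rewrite /vertex on_vec3 !mulr0 !mul0r !addr0.
- exact: (pedal_on_pencil cjE hF two0 halpha cjc dl2 cjdl dl0 cjka ka0 cE kaE).
- exact: (pedal_arc cjE hF two0 oddq halpha cjc dl2 cjdl dl0 cjka ka0 cE kaE).
move=> asq; split.
- exact: (pedal_class cjE hF two0 oddq halpha cjc dl2 cjdl dl0 cjka ka0 cE kaE).
- apply: leq_trans (card_level4_of_square cjE hF two0 oddq halpha cjc dl2 cjdl dl0 cjka ka0 asq) _.
  by rewrite leq_mul2l (card_meet4 cjE hF two0 halpha cjc dl2 cjdl dl0 cjka ka0 cE kaE).
- by move=> l _; apply: (meet4_vertex cjE hF two0 halpha cjc dl2 cjdl dl0 cjka ka0 cE kaE).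
Qed.
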